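(* For every integer $n\ge 1$, \[ \mu(\mathbb Z_n)=\begin{cases}\infty, & 1\le n\le 8,\\ 6, & n\ge 9.\end{cases} \] Equivalently, every admissible subset of $\mathbb Z_n$ is partitionable for $1\le n\le 8$, while for each $n\ge 9$ there is a six-element admissible subset of $\mathbb Z_n$ with no zero-sum triple partition.
   Context: $\mathbb Z_n$ denotes the (additive) cyclic group of order $n$. For a finite subset $S$ of an abelian group $G$, write $\sigma(S)=\sum_{s\in S}s\in G$. A zero-sum triple partition of $S$ is a decomposition $S=T_1\sqcup\cdots\sqcup T_m$ ($m\ge 0$) into pairwise disjoint subsets with $|T_i|=3$ and $\sigma(T_i)=0$ for every $i$ (for $m=0$ this is the empty partition of the empty set). A finite subset $S\subseteq G$ is admissible if $3\mid |S|$ and $\sigma(S)=0$; it is partitionable if it has a zero-sum triple partition, and non-partitionable otherwise. For a finite abelian group $G$, $\mu(G)$ is the least cardinality of a non-partitionable admissible subset of $G$, with $\mu(G)=\infty$ if no such subset exists. *)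

(* Defs.v *)
From mathcomp Require Import all_boot all_order all_algebra.

Set Implicit Arguments.
Unset Strict Implicit.
Unset Printing Implicit Defensive.


(* The additive cyclic group of order n, for n >= 1. MathComp's 'Z_n is not   *)
(* suitable, since 'Z_1 has two elements.                                     *)
Notation Zmod n := 'I_n.-1.+1.

Definition sigma (G : finZmodType) (S : {set G}) : G := (\sum_(s in S) s)%R.

Definition zero_sum_triple_partition (G : finZmodType)
    (P : {set {set G}}) (S : {set G}) : bool :=
  partition P S && [forall T in P, (#|T| == 3) && (sigma T == 0%R)].

Definition admissible (G : finZmodType) (S : {set G}) : bool :=
  (3 %| #|S|) && (sigma S == 0%R).

Definition partitionable (G : finZmodType) (S : {set G}) : bool :=
  [exists P : {set {set G}}, zero_sum_triple_partition P S].

Definition nonpartitionable_admissible (G : finZmodType) (S : {set G}) : bool :=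
  admissible S && ~~ partitionable S.

(* Some k stands for the finite value k, and None for infinity. *)
Definition mu (G : finZmodType) : option nat :=
  if [pick S : {set G} | nonpartitionable_admissible S] is Some S0 then
    Some #|[arg min_(S < S0 | nonpartitionable_admissible S) #|S|]|
  else None.

(* Main.v *)
Require Import Defs.
From mathcomp Require Import all_boot all_order all_algebra.

(** Admissible sets of cardinality 0 or 3 are trivially partitionable, so a
    non-partitionable admissible set has at least six elements, and one with
    exactly six elements is one without any zero-sum triple: the complement of
    a zero-sum triple is again one.  For [n >= 9] the set {±1, ±2, ±4} works:
    the integers obtained by adding three distinct members are nonzero and at
    most 7 in absolute value.  For [n <= 8] the only cardinality left is six,
    a finite check. *)

Set Implicit Arguments.
Unset Strict Implicit.
Unset Printing Implicit Defensive.

Import GRing.Theory.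

(** * Zero-sum triples and [mu] in an arbitrary finite abelian group *)

Section ZeroSumTriples.

Variable G : finZmodType.
Implicit Types S T : {set G}.

Definition zero_sum_triple T := (#|T| == 3) && (sigma T == 0%R).

(** Passing to duplicate-free lists lets triples be pulled back to integers and handled by
    computation. *)
Lemma zero_sum_tripleP T :
  reflect (exists s : seq G, [/\ uniq s, size s = 3, T = [set:: s]
                               & (\sum_(x <- s) x = 0)%R])
          (zero_sum_triple T).
Proof.
apply: (iffP andP) => [[/eqP cT /eqP sT]|[s [us s3 -> s0]]].
  exists (enum T); rewrite enum_uniq -cardE cT big_enum; split=> //.
  by apply/setP => x; rewrite inE mem_enum.
rewrite cardsE (card_uniqP us) s3 /sigma; split=> //.
by rewrite (eq_bigl [in s]) -?big_uniq ?s0 // => x; rewrite inE.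
Qed.

Lemma sigma_setD S T : T \subset S -> (sigma S = sigma T + sigma (S :\: T))%R.
Proof.
move=> sTS; rewrite /sigma (big_setID T) /=.
by rewrite (setIidPr sTS).
Qed.

Lemma partitionable0 : partitionable (set0 : {set G}).
Proof.
apply/existsP; exists set0; rewrite /zero_sum_triple_partition.
apply/andP; split; last by apply/forall_inP => T; rewrite inE.
by rewrite partition_set0.
Qed.

Lemma zero_sum_triple_partitionable T : zero_sum_triple T -> partitionable T.
Proof.
move=> zT; have T0 : T != set0 by rewrite -card_gt0; case/andP: zT => /eqP ->.
apply/existsP; exists [set T]; apply/andP; split.
  rewrite /partition /cover /trivIset /cover !big_set1 !eqxx inE eq_sym.
  by rewrite T0.
by apply/forall_inP => U /set1P ->.
Qed.

Lemma admissible6_partitionable S T :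
    #|S| = 6 -> sigma S = 0%R -> T \subset S -> zero_sum_triple T ->
  partitionable S.
Proof.
move=> cS sS sTS zT; have /andP[/eqP cT /eqP sT] := zT.
have cD : #|S :\: T| = 3.
  by rewrite cardsD (setIidPr sTS) cS cT.
have zD : zero_sum_triple (S :\: T).
  by rewrite /zero_sum_triple cD /= -sS (sigma_setD sTS) sT add0r.
have T0 : T != set0 by rewrite -card_gt0 cT.
have D0 : S :\: T != set0 by rewrite -card_gt0 cD.
have dTD : [disjoint T & S :\: T].
  by rewrite disjoint_sym -setI_eq0 setDE -setIA [~: T :&: T]setIC setICr setI0.
have nTD : T != S :\: T.
  by apply: contraL dTD => /eqP <-; rewrite -setI_eq0 setIid.
apply/existsP; exists [set T; S :\: T]; apply/andP; split; last first.
  by apply/forall_inP => U /set2P[] ->.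
apply/and3P; split.
- by rewrite /cover big_setU1 ?inE //= big_set1 -{1}(setIidPr sTS) setID.
- apply/trivIsetP => A B /set2P[] -> /set2P[] -> //; rewrite ?eqxx //.
  by rewrite disjoint_sym.
- by rewrite !inE negb_or eq_sym T0 eq_sym D0.
Qed.

(** The block containing any chosen element serves; [set0] is excluded because its empty partition
    has no block. *)
Lemma partitionable_zero_sum_triple S :
  S != set0 -> partitionable S -> exists2 T : {set _}, T \subset S & zero_sum_triple T.
Proof.
move=> /set0Pn[x xS] /existsP[P /andP[/and3P[/eqP cP _ _] /forall_inP zP]].
move: xS; rewrite -cP => /bigcupP[T TP _]; exists T; last exact: zP.
exact: bigcup_sup.
Qed.

Lemma admissible_small_partitionable S :
  #|S| < 6 -> admissible S -> partitionable S.
Proof.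
move=> S6 /andP[d3 sS]; have /orP[c0|c3] : (#|S| == 0) || (#|S| == 3).
  by move: S6 d3; case: #|S| => [|[|[|[|[|[|[]]]]]]].
- by move: c0; rewrite cards_eq0 => /eqP ->; exact: partitionable0.
- by apply: zero_sum_triple_partitionable; rewrite /zero_sum_triple c3.
Qed.

Lemma mu_None :
  (forall S, admissible S -> partitionable S) -> mu G = None.
Proof.
move=> allP; rewrite /mu; case: pickP => // S /andP[aS].
by rewrite allP.
Qed.

Lemma mu_Some6 S :
  #|S| = 6 -> nonpartitionable_admissible S -> mu G = Some 6.
Proof.
move=> cS nS; rewrite /mu; case: pickP => [S0 nS0|/(_ S)]; last by rewrite nS.
case: arg_minnP => // U /andP[aU nU] minU; congr Some; apply/eqP.
rewrite eqn_leq -{1}cS minU //= leqNgt; apply: contra nU => U6.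
exact: admissible_small_partitionable.
Qed.

End ZeroSumTriples.

(** * Zero sums in a cyclic group as divisibility of integers *)

Section Cyclic.

Variable m : nat.
Let u : 'I_m.+1 := inZp 1.

Lemma Zp_mulrn_eq0 k : (u *+ k == 0)%R = (m.+1 %| k).
Proof. by rewrite Zp_mulrn -val_eqE /= modnMml mul1n. Qed.

Lemma Zp_mulrz_eq0 (z : int) : (u *~ z == 0)%R = (m.+1 %| `|z|%N).
Proof.
case: z => k; first by rewrite -pmulrn Zp_mulrn_eq0.
by rewrite NegzE mulrNz oppr_eq0 -pmulrn Zp_mulrn_eq0.
Qed.

Lemma Zp_mulrn_val (x : 'I_m.+1) : (u *+ x)%R = x.
Proof. by apply: val_inj; rewrite Zp_mulrn /= modnMml mul1n modn_small. Qed.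

(** Each [x] is the multiple of the generator [u] by its own representative, so the sum is [u] times
    the sum of the representatives. *)
Lemma sum_Zp_eq0 (s : seq 'I_m.+1) :
  (\sum_(x <- s) x == 0)%R = (m.+1 %| sumn [seq val x | x <- s]).
Proof.
rewrite -Zp_mulrn_eq0 sumnE big_map.
by rewrite -sumrMnr; under [in RHS]eq_bigr do rewrite Zp_mulrn_val.
Qed.

End Cyclic.

(** * The set {±1, ±2, ±4} for order at least nine *)

Section Large.

Variable m : nat.
Hypothesis m_ge8 : 8 <= m.

Let L : seq int := [:: 1; 2; 4; -1; -2; -4]%R.
Let f (z : int) : 'I_m.+1 := (inZp 1 *~ z)%R.

(** The modulus [m.+1] exceeds 8. The bound 8 rather than 7 is what injectivity requires, since 4 -
    (-4) = 8. *)
Let f_eq0 z : `|z|%N <= 8 -> f z = 0%R -> z = 0%R.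
Proof.
move=> z8 /eqP; rewrite Zp_mulrz_eq0 => dz; apply/eqP; rewrite -absz_eq0.
apply: contraLR dz; rewrite -lt0n => z0.
by rewrite gtnNdvd // ltnS (leq_trans z8).
Qed.

Let f_inj : {in L &, injective f}.
Proof.
move=> x y xL yL /eqP; rewrite -subr_eq0 -mulrzBr => /eqP /f_eq0 e.
apply/eqP; rewrite -subr_eq0 e //.
have /allP/(_ x xL)/allP/(_ y yL) :
  all (fun x => all (fun y : int => `|x - y|%N <= 8) L) L by [].
by [].
Qed.

Definition pm124 : {set 'I_m.+1} := [set:: map f L].

Let uniq_fL : uniq (map f L).
Proof. by rewrite map_inj_in_uniq. Qed.

Lemma card_pm124 : #|pm124| = 6.
Proof. by rewrite cardsE (card_uniqP uniq_fL). Qed.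

Lemma sigma_pm124 : sigma pm124 = 0%R.
Proof.
rewrite /sigma (eq_bigl [in map f L]) => [|x]; last by rewrite inE.
rewrite -big_uniq // big_map -mulrz_sumr.
by rewrite /L !big_cons big_nil.
Qed.

Lemma pm124_no_zero_sum_triple (T : {set 'I_m.+1}) :
  T \subset pm124 -> ~~ zero_sum_triple T.
Proof.
move=> sT; apply/zero_sum_tripleP => -[s [us s3 T_def s0]].
have inL x : x \in s -> exists2 z, z \in L & x = f z.
  by move=> xs; apply/mapP; rewrite -[_ \in _]inE (subsetP sT) // T_def inE.
case: s us s3 inL s0 {T_def} => [|a [|b [|c [|]]]] // us _ inL.
have [|x xL ax] := inL a; first by rewrite !inE eqxx.
have [|y yL bx] := inL b; first by rewrite !inE eqxx orbT.
have [|z zL cx] := inL c; first by rewrite !inE eqxx !orbT.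
(* Distinctness has to be carried back to the integers, as 1 + 1 - 2 = 0 would otherwise be a
   counterexample. *)
have uxyz : uniq [:: x; y; z].
  by apply: (@map_uniq _ _ f); rewrite /= -ax -bx -cx.
have /allP/(_ x xL)/allP/(_ y yL)/allP/(_ z zL) :
  all (fun x => all (fun y => all (fun z : int => uniq [:: x; y; z] ==>
    (`|(x + (y + z))%R|%N <= 8) && (x + (y + z) != 0)%R) L) L) L by [].
rewrite uxyz => /andP[le8 nz]; rewrite !big_cons big_nil addr0 ax bx cx /f.
by rewrite -!mulrzDr => /(f_eq0 le8) /eqP; rewrite (negPf nz).
Qed.

Lemma pm124_nonpartitionable : nonpartitionable_admissible pm124.
Proof.
rewrite /nonpartitionable_admissible /admissible card_pm124 sigma_pm124 eqxx /=.
apply/negP => /partitionable_zero_sum_triple[|T sT].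
  by rewrite -card_gt0 card_pm124.
exact/negP/pm124_no_zero_sum_triple.
Qed.

End Large.

(** * Exhaustive check for order at most eight *)

Fixpoint subseqs (T : Type) (s : seq T) : seq (seq T) :=
  if s is x :: s' then
    let ss := subseqs s' in [seq x :: t | t <- ss] ++ ss
  else [:: [::]].

Lemma mem_subseqs (T : eqType) (s t : seq T) :
  (t \in subseqs s) = subseq t s.
Proof.
elim: s t => [|x s IHs] [|y t] //=; rewrite mem_cat IHs.
  by rewrite sub0seq orbT.
case: (eqVneq y x) => [->|ne_yx].
  rewrite mem_map => [|? ? [] //]; rewrite IHs.
  (* If [x :: t] occurs in [s], so does [t]; both alternatives thus reduce to the first. *)
  apply/orP/idP => [[] // | ->]; last by left.
  exact/subseq_trans/subseq_cons.
by case: mapP => // -[u _ [yx _]]; rewrite yx eqxx in ne_yx.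
Qed.

(** Subsets of the group are encoded as increasing lists of residues, so that the check runs by
    evaluation. *)
Definition sub6_check (n : nat) : bool :=
  all (fun s => (size s == 6) && (n %| sumn s) ==>
         has (fun t => (size t == 3) && (n %| sumn t)) (subseqs s))
      (subseqs (iota 0 n)).

Lemma sub6_checkP (m : nat) (S : {set 'I_m.+1}) :
    sub6_check m.+1 -> #|S| = 6 -> sigma S = 0%R ->
  exists2 T : {set _}, T \subset S & zero_sum_triple T.
Proof.
move=> /allP chk cS; rewrite /sigma -big_enum => /eqP; rewrite sum_Zp_eq0 => dS.
(* [enum S] follows the order of ['I_m.+1], so its values form a subsequence of [iota 0 m.+1]. *)
have /chk : [seq val x | x <- enum S] \in subseqs (iota 0 m.+1).
  by rewrite mem_subseqs -val_enum_ord map_subseq // enumT filter_subseq.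
rewrite size_map -cardE cS dS /= => /hasP[t].
(* Written as a mask, the triple of residues found lifts to a sublist of [enum S]. *)
rewrite mem_subseqs => /subseqP[b _ ->]; rewrite -map_mask size_map.
move=> /andP[/eqP s3]; rewrite -sum_Zp_eq0 => /eqP s0.
exists [set:: mask b (enum S)].
  by apply/subsetP => x; rewrite inE => /mem_mask; rewrite mem_enum.
by apply/zero_sum_tripleP; exists (mask b (enum S)); rewrite mask_uniq ?enum_uniq.
Qed.

Lemma small_admissible_partitionable (m : nat) (S : {set 'I_m.+1}) :
  m < 8 -> admissible S -> partitionable S.
Proof.
move=> m8 aS; case: (ltnP #|S| 6) => [lt6|ge6].
  exact: admissible_small_partitionable.
have /andP[d3 /eqP s0] := aS.
have c6 : #|S| = 6.
  have le8 : #|S| <= 8 by rewrite (leq_trans (max_card _)) ?card_ord.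
  by move: ge6 le8 d3; case: #|S| => [|[|[|[|[|[|[|[|[|]]]]]]]]].
have chk : sub6_check m.+1.
  (* One evaluation covers the orders 1 to 8; below 6 the check is vacuous. *)
  have /allP -> // : all sub6_check (iota 1 8) by vm_compute.
  by rewrite mem_iota ltnS.
have [T sT zT] := sub6_checkP chk c6 s0.
exact: admissible6_partitionable zT.
Qed.

Theorem corollary1p2 (n : nat) (n_ge1 : 1 <= n) :
  [/\ mu (Zmod n) = (if n <= 8 then None else Some 6),
      n <= 8 -> forall S : {set Zmod n}, admissible S -> partitionable S
    & 9 <= n -> exists S : {set Zmod n},
        [/\ #|S| = 6, admissible S
          & ~ exists P : {set {set Zmod n}}, zero_sum_triple_partition P S]].
Proof.
(* With [n] written as [m.+1], [Zmod n] reduces to ['I_m.+1], and [n <= 8] becomes [m < 8]. *)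
case: n n_ge1 => // m _ /=; case: (ltnP m 8) => m8.
  have part S := @small_admissible_partitionable m S m8.
  by split=> //; [exact: mu_None | rewrite ltnS leqNgt m8].
have [c6 np] := (card_pm124 m8, pm124_nonpartitionable m8).
split=> // [|_]; first exact: mu_Some6 c6 np.
have /andP[aS nS] := np; exists (pm124 m); split=> //.
by move=> /existsP; exact/negP.
Qed.
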